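(* Let $q=1$. Assume that there exists a statistic $T=t(X)$ such that, for all $\theta\in\Theta$, all $z\in\mathcal{Z}$ and all $x\in\mathcal{X}$, $$p(x;\theta,z)=f_t(x;\theta)\,h\{t(x);\theta,z\}.$$ Suppose moreover that, for each $\theta\in\Theta$, the class $\{P^t_{\theta z}:z\in\mathcal{Z}\}$ is complete, where $P^t_{\theta z}$ is the distribution of $T(X)$ when $X\sim P_{\theta z}$. Then the regular inference function given by $$\Psi(x;\theta)=\frac{\partial}{\partial\theta}\log f_t(x;\theta),\qquad x\in\mathcal{X},\ \theta\in\Theta,$$ is optimal. Moreover, if $\Phi$ is also an optimal inference function, then $\Phi$ is equivalent to $\Psi$.
   Context: Setting. $\lambda$ is a $\sigma$-finite measure on a measurable space $(\mathcal{X},\mathcal{A})$; $\mathcal{P}^*=\{p(\cdot;\theta,z)=dP_{\theta z}/d\lambda:\theta\in\Theta,\ z\in\mathcal{Z}\}$ is a family of probability densities, $\Theta\subseteq\mathbb{R}$ is open (one-dimensional parameter of interest), $\mathcal{Z}$ is an arbitrary set, $(\theta,z)\mapsto p(\cdot;\theta,z)$ is a bijection onto $\mathcal{P}^*$, and all densities are strictly positive. The partial score $l(\cdot;\theta,z)=\frac{\partial}{\partial\theta}\log p(\cdot;\theta,z)$ is well defined $\lambda$-a.e., belongs to $L^2_0(P_{\theta z})$ ($P_{\theta z}$-square-integrable functions with mean zero), and is presupposed to satisfy the regularity conditions (with $z$ as an additional argument) listed next. Regular inference functions. A regular inference function is a function $\Psi:\mathcal{X}\times\Theta\to\mathbb{R}$,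 measurable in $x$, such that for all $\theta\in\Theta$ and $z\in\mathcal{Z}$: $\Psi(\cdot;\theta)\in L^2_0(P_{\theta z})$; $\partial\Psi(\cdot;\theta)/\partial\theta$ exists almost everywhere; $\frac{\partial}{\partial\theta}\int\Psi(x;\theta)p(x;\theta,z)\lambda(dx)=\int\frac{\partial}{\partial\theta}[\Psi(x;\theta)p(x;\theta,z)]\lambda(dx)$; $\mathrm{E}_{\theta z}\{\partial\Psi(\cdot;\theta)/\partial\theta\}$ is well defined and nonzero; and $\mathrm{E}_{\theta z}\{\Psi^2(\cdot;\theta)\}>0$. In the theorem, $\partial\log f_t/\partial\theta$ is taken to be a regular inference function. The Godambe information of $\Psi$ is $J_\Psi(\theta,z)=[\mathrm{E}_{\theta z}\{\partial\Psi(\cdot;\theta)/\partial\theta\}]^2/\mathrm{E}_{\theta z}\{\Psi^2(\cdot;\theta)\}$. A regular inference function $\Psi$ is optimal if $J_\Phi(\theta,z)\le J_\Psi(\theta,z)$ for all $\theta\in\Theta$, all $z\in\mathcal{Z}$ and every regular inference function $\Phi$. Two regular (quasi-)inference functions $\Psi,\Phi$ are equivalent if for each $(\theta,z)$ there is a nonzero constant $K(\theta,z)$ (not depending on $x$) with $\Psi(x;\theta)=K(\theta,z)\Phi(x;\theta)$ for $P_{\theta z}$-almost all $x$. A class of distributions is complete if the only functions (up to a.s. equality under each member) with integral zero under every member of the class are the zero functions. *)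

(* Defs.v *)
From HB Require Import structures.
From mathcomp Require Import all_boot all_order all_algebra.
From mathcomp Require Import all_classical all_reals all_analysis.

Set Implicit Arguments.
Unset Strict Implicit.
Unset Printing Implicit Defensive.

Import Order.TTheory GRing.Theory Num.Theory.
Import numFieldNormedType.Exports.

Local Open Scope classical_set_scope.
Local Open Scope ring_scope.

(* Functions of the parameter theta are total on R and only constrained on the
   parameter set Theta.  As Theta is open, derivatives at a point of Theta do
   not depend on values outside Theta. *)

Definition is_density d (X : measurableType d) (R : realType)
    (lambda : {measure set X -> \bar R}) (P : probability X R) (p : X -> R) : Prop :=
  measurable_fun setT p /\
  forall A : set X, measurable A -> P A = (\int[lambda]_(x in A) (p x)%:E)%E.

(* Integrability of a function that is meaningful only almost everywhere, such
   as an a.e. existing derivative: `integrable` would require measurability on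
   the exceptional null set as well. *)
Definition ae_integrable d (X : measurableType d) (R : realType)
    (P : probability X R) (g : X -> R) : Prop :=
  exists2 g' : X -> R, P.-integrable setT (EFin \o g')
                     & {ae P, forall x, g x = g' x}.

Definition L20 d (X : measurableType d) (R : realType)
    (P : probability X R) (g : X -> R) : Prop :=
  g \in Lfun P 2%:E /\ ('E_P[g] = 0)%E.

(* The partial derivative in theta.  It takes a default value at the points x
   where the derivative does not exist; in every use these form a null set, so
   expectations do not depend on that value. *)
Definition dpar (X : Type) (R : realType) (Z : Type) (Psi : X -> R -> Z -> R) :
    X -> R -> Z -> R :=
  fun x theta z => derive1 (fun u => Psi x u z) theta.

Definition score (X : Type) (R : realType) (Z : Type) (p : X -> R -> Z -> R) :
    X -> R -> Z -> R :=
  dpar (fun x theta z => ln (p x theta z)).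

(* Regularity conditions for functions of (x, theta) that may also depend on the
   nuisance parameter z.  In rqi_interchange the left integral is real-valued
   and the right one extended-real-valued, so that the equality entails that
   the integral on the right is finite.  Measurability in x is part of `Lfun`
   in rqi_L20. *)
Record regular_quasi_inference d (X : measurableType d) (R : realType)
    (lambda : {measure set X -> \bar R}) (Theta : set R) (Z : Type)
    (P : R -> Z -> probability X R) (p : X -> R -> Z -> R)
    (Psi : X -> R -> Z -> R) : Prop := RegularQuasiInference {
  rqi_L20 : forall theta z, Theta theta ->
    L20 (P theta z) (fun x => Psi x theta z) ;
  rqi_derivable : forall theta z, Theta theta ->
    {ae lambda, forall x, derivable (fun u => Psi x u z) theta 1} ;
  rqi_interchange : forall theta z, Theta theta ->
    (derive1 (fun u => \int[lambda]_x (Psi x u z * p x u z)) theta)%:E =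
    (\int[lambda]_x (dpar (fun x u z => Psi x u z * p x u z)%R x theta z)%:E)%E ;
  rqi_dpar_integrable : forall theta z, Theta theta ->
    ae_integrable (P theta z) (fun x => dpar Psi x theta z) ;
  rqi_dpar_neq0 : forall theta z, Theta theta ->
    ('E_(P theta z)[fun x => dpar Psi x theta z] != 0)%E ;
  rqi_sqr_gt0 : forall theta z, Theta theta ->
    (0 < 'E_(P theta z)[fun x => (Psi x theta z ^+ 2)%R])%E }.

Definition regular_inference d (X : measurableType d) (R : realType)
    (lambda : {measure set X -> \bar R}) (Theta : set R) (Z : Type)
    (P : R -> Z -> probability X R) (p : X -> R -> Z -> R)
    (Psi : X -> R -> R) : Prop :=
  regular_quasi_inference lambda Theta P p (fun x theta _ => Psi x theta).

Definition godambe d (X : measurableType d) (R : realType) (Z : Type)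
    (P : R -> Z -> probability X R) (Psi : X -> R -> R) (theta : R) (z : Z) : R :=
  fine ('E_(P theta z)[fun x => derive1 (Psi x) theta])%E ^+ 2 /
  fine ('E_(P theta z)[fun x => (Psi x theta ^+ 2)%R])%E.

Definition optimal d (X : measurableType d) (R : realType)
    (lambda : {measure set X -> \bar R}) (Theta : set R) (Z : Type)
    (P : R -> Z -> probability X R) (p : X -> R -> Z -> R)
    (Psi : X -> R -> R) : Prop :=
  regular_inference lambda Theta P p Psi /\
  forall Phi : X -> R -> R, regular_inference lambda Theta P p Phi ->
  forall theta z, Theta theta ->
    godambe P Phi theta z <= godambe P Psi theta z.

Definition equivalent d (X : measurableType d) (R : realType)
    (Theta : set R) (Z : Type) (P : R -> Z -> probability X R)
    (Psi Phi : X -> R -> R) : Prop :=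
  forall theta z, Theta theta -> exists2 K : R, K != 0 &
    {ae P theta z, forall x, Psi x theta = K * Phi x theta}.

(* Having integral zero under Q presupposes being Q-integrable. *)
Definition complete_class d (S : measurableType d) (R : realType)
    (C : set (probability S R)) : Prop :=
  forall g : S -> R,
    (forall Q, C Q -> Q.-integrable setT (EFin \o g)) ->
    (forall Q, C Q -> (\int[Q]_s (g s)%:E = 0)%E) ->
    forall Q, C Q -> {ae Q, forall s, g s = 0}.

(* Main.v *)
(* Differentiating E[Phi] = 0 in theta gives E[dPhi/dtheta] = - E[Phi l], where
   l is the score. By the factorization, l = Psi + k(T) with k the derivative of
   log h in theta. At fixed theta the conditional expectation E[Phi | T] can be
   chosen independently of z, and it has mean zero for all z, so it vanishes by
   completeness; hence E[Phi k(T)] = 0 and E[Phi l] = E[Phi Psi]. Thus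
   J_Phi = E[Phi Psi]^2 / E[Phi^2], while J_Psi = E[Psi^2], and the theorem is
   the Cauchy-Schwarz inequality with its equality case. *)
Require Import Defs.
From HB Require Import structures.
From mathcomp Require Import all_boot all_order all_algebra.
From mathcomp Require Import all_classical all_reals all_analysis.
From mathcomp Require Import measurable_realfun ring.
Import Order.TTheory GRing.Theory Num.Theory.
Import numFieldNormedType.Exports.
Set Implicit Arguments.
Unset Strict Implicit.
Unset Printing Implicit Defensive.
Local Open Scope classical_set_scope.
Local Open Scope ring_scope.

(** * Integrals of almost everywhere equal functions, measurable or not *)

Section nonmeasurable_ae.
Local Open Scope ereal_scope.
Context d (T : measurableType d) (R : realType).
Variable mu : {measure set T -> \bar R}.
Import HBNNSimple.

(** The integral of a nonnegative function is the supremum over simple functions below it. A simple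
    function below [f], set to zero on the null set [N], lies below [g] and keeps its integral. *)
Lemma ge0_ae_le_integralT (f g : T -> \bar R) :
  (forall x, 0 <= f x) -> (forall x, 0 <= g x) ->
  {ae mu, forall x, f x = g x} -> \int[mu]_x f x <= \int[mu]_x g x.
Proof.
move=> f0 g0 [N [mN N0 fgN]].
rewrite [leLHS]ge0_integralTE// [leRHS]ge0_integralTE//.
apply: ge_ereal_sup => /= _ [h hf <-].
have mNC : measurable (~` N) by exact: measurableC.
rewrite -integralT_nnsfun (ge0_negligible_integral _ _ _ _ N0)//.
- rewrite setTD integral_mkcond.
  rewrite (_ : (fun x => (h x)%:E) \_ (~` N) = EFin \o proj_nnsfun h mNC).
    2: by apply/funext => x; rewrite -mrestrict /= !patchE; case: ifP.
  rewrite [leLHS]integralT_nnsfun; apply: ereal_sup_ubound.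
  exists (proj_nnsfun h mNC) => // x; rewrite -mrestrict patchE.
  case: ifPn => [/set_mem xN|_]; last by rewrite g0.
  rewrite (le_trans (hf x))// le_eqVlt; apply/orP; left; apply/eqP.
  by apply: contrapT => fgx; exact/xN/fgN.
- by apply/measurable_EFinP.
- by move=> x _; rewrite lee_fin.
Qed.

(* [ae_eq_integral] asks for both functions to be measurable. *)
Lemma ae_eq_integralT (f g : T -> \bar R) :
  {ae mu, forall x, f x = g x} -> \int[mu]_x f x = \int[mu]_x g x.
Proof.
move=> fg; rewrite integralE [RHS]integralE.
have gf : {ae mu, forall x, g x = f x} by apply: filterS fg => x.
congr (_ - _); apply/eqP; rewrite eq_le; apply/andP; split;
  apply: ge0_ae_le_integralT => //.
- by apply: filterS fg => x; rewrite !funeposE => ->.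
- by apply: filterS gf => x; rewrite !funeposE => ->.
- by apply: filterS fg => x; rewrite !funenegE => ->.
- by apply: filterS gf => x; rewrite !funenegE => ->.
Qed.

End nonmeasurable_ae.

(** * Integration and null sets under a density *)

Section density.
Local Open Scope ereal_scope.
Context d (T : measurableType d) (R : realType).
Variables (mu : {sigma_finite_measure set T -> \bar R}).
Variables (nu : {finite_measure set T -> \bar R}) (p : T -> R).
Hypotheses (mp : measurable_fun setT p) (p0 : forall x, (0 <= p x)%R).
Hypothesis nuE : forall A, measurable A -> nu A = \int[mu]_(x in A) (p x)%:E.

Let numu : nu `<< mu.
Proof.
apply/null_content_dominatesP => A mA muA; rewrite nuE//.
by apply: null_set_integral => //; exact/measurable_funTS/measurable_EFinP.
Qed.

(** The density [p] and the Radon-Nikodym derivative of [nu] have the same integral over every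
    measurable set, so they agree almost everywhere and the change of variables formula passes to
    [p]. *)
Lemma ge0_integral_density (w : T -> \bar R) :
  measurable_fun setT w -> (forall x, 0 <= w x) ->
  \int[nu]_x w x = \int[mu]_x (w x * (p x)%:E).
Proof.
move=> mw w0.
rewrite -(Radon_Nikodym_SigmaFinite.change_of_variables numu)//.
have fi := Radon_Nikodym_SigmaFinite.f_integrable numu.
have f0 := Radon_Nikodym_SigmaFinite.f_ge0 numu.
apply: ge0_ae_eq_integral => //.
- exact/emeasurable_funM/(measurable_int _ fi).
- exact/emeasurable_funM/measurable_EFinP.
- by move=> x _; exact: mule_ge0.
- by move=> x _; rewrite mule_ge0// lee_fin.
- have := @integral_ae_eq _ _ _ mu setT measurableT (EFin \o p) _ fi.
  move=> /(_ _ _)[]; first exact/measurable_EFinP.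
    by move=> E _ mE; rewrite -nuE// -Radon_Nikodym_SigmaFinite.f_integral.
  move=> N [mN N0 sN]; exists N; split => // x /= h; apply: sN => /= h'.
  by apply: h => _; rewrite h'.
Qed.

Lemma integral_density (w : T -> R) : measurable_fun setT w ->
  \int[nu]_x (w x)%:E = \int[mu]_x (w x * p x)%:E.
Proof.
move=> mw; rewrite integralE [RHS]integralE.
have mw' : measurable_fun setT (EFin \o w) by exact/measurable_EFinP.
rewrite !ge0_integral_density//;
  [|exact: measurable_funeneg|exact: measurable_funepos].
congr (_ - _); apply: eq_integral => x _.
- rewrite !funeposE -!EFin_max -EFinM; congr EFin.
  by rewrite maxr_pMl// mul0r.
- rewrite !funenegE -!EFinN -!EFin_max -EFinM; congr EFin.
  by rewrite maxr_pMl// mul0r mulNr.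
Qed.

(** A strictly positive function integrates to zero only over a null set. This carries almost
    everywhere statements between the dominating measure and the model. *)
Lemma negligible_density (N : set T) : (forall x, 0 < p x)%R ->
  nu.-negligible N <-> mu.-negligible N.
Proof.
move=> pgt0; split=> -[A [mA A0 NA]]; exists A; split => //.
  move: A0; rewrite nuE// => A0.
  have /ae_eq_integral_abs : \int[mu]_(x in A) `|(p x)%:E| = 0.
    by rewrite -[RHS]A0; apply: eq_integral => x _; rewrite gee0_abs ?lee_fin.
  move=> /(_ mA)[|B [mB B0 sB]]; first exact/measurable_funTS/measurable_EFinP.
  apply: (subset_measure0 mA mB _ B0) => x Ax; apply: sB => /= /(_ Ax)[] /eqP.
  by rewrite gt_eqF.
by move/null_content_dominatesP : numu => h; exact: h.
Qed.

End density.

Lemma finite_measure_of d (T : measurableType d) (R : realType)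
    (m : set T -> \bar R) :
  m set0 = 0%E -> (forall A, 0 <= m A)%E -> semi_sigma_additive m ->
  fin_num_fun m ->
  exists nu : {finite_measure set T -> \bar R}, nu = m :> (set T -> \bar R).
Proof.
move=> m0 m_ge0 m_sigma m_fin.
pose mM := isMeasure.Build _ _ _ m m0 m_ge0 m_sigma.
pose M : {measure set T -> \bar R} := HB.pack m mM.
pose mF := Measure_isFinite.Build _ _ _ M m_fin.
pose F : {finite_measure set T -> \bar R} := HB.pack m mM mF.
by exists F.
Qed.

(** * Conditional expectation given a statistic *)

Section conditional_expectation.
Local Open Scope ereal_scope.
Context d d' (X : measurableType d) (S : measurableType d') (R : realType).
Variables (P : probability X R) (t : {mfun X >-> S}).

Let mt A : measurable A -> measurable (t @^-1` A).
Proof. exact: measurable_funPTI. Qed.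

(** [g] is a version of E[u | T = s]. Nonnegativity of [u] makes u dP a measure, and [g] is the
    Radon-Nikodym derivative of its image under [t] with respect to the distribution of [t]. *)
Lemma ge0_conditional_expectation (u : X -> R) :
  (forall x, 0 <= u x)%R -> P.-integrable setT (EFin \o u) ->
  exists g : S -> R, [/\ measurable_fun setT g, (forall s, 0 <= g s)%R &
    forall w : S -> R, measurable_fun setT w -> (forall s, 0 <= w s)%R ->
    \int[P]_x (w (t x) * u x)%:E = \int[P]_x (w (t x) * g (t x))%:E].
Proof.
move=> u0 iu; have mu : measurable_fun setT u.
  by apply/measurable_EFinP; exact: measurable_int iu.
(* [nu] is the measure u dP, and [nt] below is its image on [S]. *)
have [nu nuE] : exists nu : {finite_measure set X -> \bar R},
    nu = (fun A => \int[P]_(x in A) (u x)%:E) :> (set X -> \bar R).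
  apply: finite_measure_of.
  - by rewrite integral_set0.
  - by move=> A; apply: integral_ge0 => x _; rewrite lee_fin.
  - apply: semi_sigma_additive_nng_induced; first exact: measurable_int iu.
    by move=> x; rewrite lee_fin.
  - move=> A mA; apply: (@integrable_fin_num _ _ _ P A mA (EFin \o u)).
    exact: integrableS iu.
have [nt ntE] : exists nt : {finite_measure set S -> \bar R},
    nt = pushforward nu t :> (set S -> \bar R).
  apply: finite_measure_of; [exact: measure0|by move=> A; exact: measure_ge0
    |exact: measure_semi_sigma_additive|].
  by move=> A mA; apply: fin_num_measure; exact: mt.
pose Q : probability S R := distribution P t.
have ntQ : nt `<< Q.
  apply/null_content_dominatesP => A mA QA0.
  rewrite ntE /pushforward nuE; apply: null_set_integral => //; first exact: mt.
  exact/measurable_funTS/measurable_EFinP.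
pose f := Radon_Nikodym_SigmaFinite.f nt Q.
have fi := Radon_Nikodym_SigmaFinite.f_integrable ntQ.
have f0 := Radon_Nikodym_SigmaFinite.f_ge0 ntQ.
have ff := Radon_Nikodym_SigmaFinite.f_fin_num ntQ.
have mg : measurable_fun setT (fine \o f).
  apply: (measurableT_comp _ (measurable_int _ fi)).
  by [].
exists (fine \o f); split => //.
  by move=> s; rewrite /= fine_ge0.
move=> w mw w0.
have mew : measurable_fun setT (EFin \o w) by exact/measurable_EFinP.
have ew0 s : 0 <= (EFin \o w) s by rewrite lee_fin.
(* The integral is moved from [P] to [nu], pushed to [nt] on [S], rewritten against [Q] with density
   [f], and pulled back to [X]. *)
transitivity (\int[nu]_x (w (t x))%:E).
  rewrite (@ge0_integral_density _ _ _ P nu u)//.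
  - by move=> A mA; rewrite nuE.
  - by apply/measurable_EFinP; exact: measurableT_comp.
  - by move=> x; rewrite lee_fin.
transitivity (\int[nt]_s (w s)%:E).
  transitivity (\int[pushforward nu t]_s (EFin \o w) s).
    by rewrite ge0_integral_pushforward.
  apply: eq_measure_integral => A mA _; exact: esym (congr1 (@^~ A) ntE).
rewrite -(Radon_Nikodym_SigmaFinite.change_of_variables ntQ ew0)//.
rewrite ge0_integral_pushforward//.
- apply: eq_integral => x _ /=.
  by rewrite EFinM fineK.
- by apply: emeasurable_funM => //; exact: measurable_int fi.
- by move=> s _; exact: mule_ge0.
Qed.

End conditional_expectation.

Lemma le_norm_integrable d (T : measurableType d) (R : realType)
    (mu : {measure set T -> \bar R}) (f g : T -> R) :
  measurable_fun setT f -> (forall x, `|f x| <= `|g x|) ->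
  mu.-integrable setT (EFin \o g) -> mu.-integrable setT (EFin \o f).
Proof.
move=> mf fg; apply: le_integrable => //; first exact/measurable_EFinP.
by move=> x _; rewrite /= lee_fin.
Qed.

Lemma EFin_funrpos (T : Type) (R : realDomainType) (f : T -> R) (x : T) :
  ((fun x => (f x)%:E)^\+ x)%E = (Num.max (f x) 0)%:E.
Proof. by rewrite funeposE EFin_max. Qed.

Lemma EFin_funrneg (T : Type) (R : realDomainType) (f : T -> R) (x : T) :
  ((fun x => (f x)%:E)^\- x)%E = (Num.max (- f x) 0)%:E.
Proof. by rewrite funenegE EFin_max EFinN. Qed.

Lemma max0_le_norm (R : realDomainType) (a : R) : `|Num.max a 0| <= `|a|.
Proof. by case: (lerP a 0) => [_|/gtr0_norm->]; rewrite ?normr0. Qed.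

Lemma subr_max0 (R : realDomainType) (a : R) :
  Num.max a 0 - Num.max (- a) 0 = a.
Proof.
case: (lerP a 0) => a0.
  by rewrite max_l ?oppr_ge0// sub0r opprK.
by rewrite max_r ?oppr_le0 ?subr0// ltW.
Qed.

(** * Completeness and orthogonality to functions of the statistic *)

Section complete_orthogonal.
Local Open Scope ereal_scope.
Context d d' (X : measurableType d) (S : measurableType d') (R : realType).
Variables (lambda : {sigma_finite_measure set X -> \bar R}) (Z : Type).
Variables (P : Z -> probability X R) (p : X -> Z -> R) (t : {mfun X >-> S}).
Variables (q : X -> R) (h : S -> Z -> R).
Hypothesis p_density : forall z, is_density lambda (P z) (p^~ z).
Hypothesis p_gt0 : forall x z, (0 < p x z)%R.
Hypothesis q_gt0 : forall x, (0 < q x)%R.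
Hypothesis h_meas : forall z, measurable_fun setT (h^~ z).
Hypothesis p_factor : forall x z, p x z = (q x * h (t x) z)%R.

Let h_gt0 x z : (0 < h (t x) z)%R.
Proof. by move: (p_gt0 x z); rewrite p_factor pmulr_rgt0. Qed.

(* The absolute values make [ratio] nonnegative off the range of [t], where [h]
   is unconstrained; [powR] is used as an inverse known to be measurable. *)
Let ratio z z' s : R := (`|h s z'| * (`|h s z| `^ (-1)))%R.

Let ratio_meas z z' : measurable_fun setT (ratio z z').
Proof.
apply: measurable_funM; first exact: measurableT_comp.
apply: (measurableT_comp (measurable_powR _)); exact: measurableT_comp.
Qed.

Let ratio_ge0 z z' s : (0 <= ratio z z' s)%R.
Proof. by rewrite /ratio mulr_ge0// powR_ge0. Qed.

(** The factor [q] is free of [z] and cancels from the likelihood ratio, which is therefore a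
    function of the statistic alone. *)
Let p_ratio x z z' : p x z' = (ratio z z' (t x) * p x z)%R.
Proof.
rewrite /ratio powR_inv1// !gtr0_norm// !p_factor.
by rewrite mulrACA mulVf ?gt_eqF// mulr1 mulrC.
Qed.

Let integral_ratio z z' (v : X -> R) :
  measurable_fun setT v -> (forall x, 0 <= v x)%R ->
  \int[P z']_x (v x)%:E = \int[P z]_x (ratio z z' (t x) * v x)%:E.
Proof.
move=> mv v0; have [[mz Pz] [mz' Pz']] := (p_density z, p_density z').
rewrite (integral_density (mu := lambda) (nu := P z') mz')//; last first.
  by move=> x; exact: ltW.
rewrite (integral_density (mu := lambda) (nu := P z) mz)//; last 2 first.
- by move=> x; exact: ltW.
- by apply: measurable_funM => //; exact: measurableT_comp.
by apply: eq_integral => x _; rewrite (p_ratio x z z') mulrA (mulrC (v x)).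
Qed.

(** This is sufficiency of [t] at work: passing from [P z] to [P z'] multiplies by a function of
    [t], which is an admissible weight [w]. A conditional expectation computed under [z] thus has
    the right mean under every [z']. *)
Let conditional_ratio z z' (u : X -> R) (g : S -> R) :
  measurable_fun setT u -> (forall x, 0 <= u x)%R ->
  measurable_fun setT g -> (forall s, 0 <= g s)%R ->
  (forall w : S -> R, measurable_fun setT w -> (forall s, 0 <= w s)%R ->
    \int[P z]_x (w (t x) * u x)%:E = \int[P z]_x (w (t x) * g (t x))%:E) ->
  \int[P z']_x (g (t x))%:E = \int[P z']_x (u x)%:E.
Proof.
move=> mu u0 mg g0 ug.
rewrite (integral_ratio z z')//; last exact: measurableT_comp.
by rewrite (integral_ratio z z' mu u0)// ug.
Qed.

Hypothesis t_complete :
  complete_class [set (distribution (P z) t : probability S R) | z in [set: Z]].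

Variable Phi : X -> R.
Hypothesis iPhi : forall z, (P z).-integrable setT (EFin \o Phi).
Hypothesis Phi_mean0 : forall z, \int[P z]_x (Phi x)%:E = 0.

Let mPhi (z : Z) : measurable_fun setT Phi.
Proof. by apply/measurable_EFinP; exact: measurable_int (iPhi z). Qed.

(** [Phi] is split into its parts [u1] and [u2], whose conditional expectations [g1] and [g2] agree
    almost surely by completeness, so [u1] and [u2] have equal integrals against any weight [w] of
    the statistic. *)
Let ge0_complete_orthogonal z (w : S -> R) :
  measurable_fun setT w -> (forall s, 0 <= w s)%R ->
  (P z).-integrable setT (EFin \o (fun x => w (t x) * Phi x)%R) ->
  \int[P z]_x (w (t x) * Phi x)%:E = 0.
Proof.
move=> mw w0 iw.
pose u1 x := Num.max (Phi x) 0%R; pose u2 x := Num.max (- Phi x)%R 0%R.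
have mu1 : measurable_fun setT u1 by apply: measurable_maxr => //; exact: mPhi.
have mu2 : measurable_fun setT u2.
  by apply: measurable_maxr => //; apply: measurableT_comp => //; exact: mPhi.
have u1_ge0 x : (0 <= u1 x)%R by rewrite le_max lexx orbT.
have u2_ge0 x : (0 <= u2 x)%R by rewrite le_max lexx orbT.
have i1 z' : (P z').-integrable setT (EFin \o u1).
  apply: (le_norm_integrable (g := Phi)); [exact: mu1|move=> x|exact: iPhi].
  exact: max0_le_norm.
have i2 z' : (P z').-integrable setT (EFin \o u2).
  apply: (le_norm_integrable (g := Phi)); [exact: mu2|move=> x|exact: iPhi].
  by rewrite (le_trans (max0_le_norm _))// normrN.
have [g1 [mg1 g1_ge0 g1E]] := ge0_conditional_expectation t u1_ge0 (i1 z).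
have [g2 [mg2 g2_ge0 g2E]] := ge0_conditional_expectation t u2_ge0 (i2 z).
have G1 z' := conditional_ratio z' mu1 u1_ge0 mg1 g1_ge0 g1E.
have G2 z' := conditional_ratio z' mu2 u2_ge0 mg2 g2_ge0 g2E.
have ge0_integrable z' (g u : X -> R) :
    measurable_fun setT g -> (forall x, 0 <= g x)%R ->
    (forall x, 0 <= u x)%R -> (P z').-integrable setT (EFin \o u) ->
    \int[P z']_x (g x)%:E = \int[P z']_x (u x)%:E ->
    (P z').-integrable setT (EFin \o g).
  move=> mg g0 u0 /integrableP[_ iu] gu; apply/integrableP; split.
    exact/measurable_EFinP.
  under eq_integral do rewrite gee0_abs ?lee_fin//.
  rewrite gu; under eq_integral do rewrite -[(u _)%:E]gee0_abs ?lee_fin//.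
  by [].
have ig1 z' : (P z').-integrable setT (EFin \o (g1 \o t)).
  have mgt : measurable_fun setT (g1 \o t) by exact: measurableT_comp.
  apply: (ge0_integrable _ _ _ mgt _ u1_ge0 (i1 z') (G1 z')) => x.
  exact: g1_ge0.
have ig2 z' : (P z').-integrable setT (EFin \o (g2 \o t)).
  have mgt : measurable_fun setT (g2 \o t) by exact: measurableT_comp.
  apply: (ge0_integrable _ _ _ mgt _ u2_ge0 (i2 z') (G2 z')) => x.
  exact: g2_ge0.
(* [G] is a version of E[Phi | T] built under the fixed [z]; by [G1] and [G2] its mean under each
   [z'] is that of [Phi], namely zero. *)
pose G := (g1 \- g2)%R.
have mG : measurable_fun setT (EFin \o G).
  by apply/measurable_EFinP; exact: measurable_funB.
have iG z' : (P z').-integrable setT (EFin \o G \o t).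
  exact: (integrableB measurableT (ig1 z') (ig2 z')).
have : {ae (distribution (P z) t : probability S R), forall s, G s = 0%R}.
  apply: (t_complete (g := G)); last by exists z.
    move=> _ [z' _ <-]; apply: integrable_pushforward => //.
    by rewrite preimage_setT; exact: iG.
  move=> _ [z' _ <-]; rewrite integral_pushforward//; last first.
    by rewrite preimage_setT; exact: iG.
  rewrite preimage_setT integralB_EFin//; [|exact: ig1|exact: ig2].
  rewrite /= G1 G2 -(integralB_EFin measurableT (i1 z') (i2 z')).
  rewrite -[RHS](Phi_mean0 z'); apply: eq_integral => x _.
  by rewrite -EFinB subr_max0.
move=> [N [mN N0 sN]].
have g12 : {ae P z, forall x,
    (w (t x) * g1 (t x))%:E = (w (t x) * g2 (t x))%:E}.
  exists (t @^-1` N); split => //; first exact: measurable_funPTI.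
  move=> x /= g1x; apply: sN => /= /eqP; rewrite subr_eq0 => /eqP g1E'.
  by apply: g1x; rewrite g1E'.
have w12 : \int[P z]_x (w (t x) * u1 x)%:E = \int[P z]_x (w (t x) * u2 x)%:E.
  by rewrite g1E// g2E//; exact: ae_eq_integralT.
rewrite integralE.
under eq_integral do rewrite EFin_funrpos.
under [X in _ - X]eq_integral do rewrite EFin_funrneg.
have -> : \int[P z]_x (Num.max (w (t x) * Phi x)%R 0%R)%:E =
    \int[P z]_x (w (t x) * u1 x)%:E.
  by apply: eq_integral => x _; rewrite maxr_pMr// mulr0.
have -> : \int[P z]_x (Num.max (- (w (t x) * Phi x))%R 0%R)%:E =
    \int[P z]_x (w (t x) * u2 x)%:E.
  by apply: eq_integral => x _; rewrite maxr_pMr// mulr0 mulrN.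
(* Cancelling the two equal integrals requires them to be finite, which follows from the
   integrability of the product of [w] and [Phi]. *)
rewrite w12 subee// -w12.
apply: (@integrable_fin_num _ _ _ _ _ measurableT (EFin \o _)).
apply: (le_norm_integrable (g := (fun x => w (t x) * Phi x)%R)) => //.
  by apply: measurable_funM => //; exact: measurableT_comp.
by move=> x; rewrite !normrM ler_wpM2l// max0_le_norm.
Qed.

(** The positive and negative parts of [k] fall under the nonnegative case, because their products
    with [Phi] are dominated by that of [k]. *)
Lemma complete_orthogonal z (k : S -> R) : measurable_fun setT k ->
  (P z).-integrable setT (EFin \o (fun x => k (t x) * Phi x)%R) ->
  \int[P z]_x (k (t x) * Phi x)%:E = 0.
Proof.
move=> mk ik.
pose k1 s := Num.max (k s) 0%R; pose k2 s := Num.max (- k s)%R 0%R.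
have mk1 : measurable_fun setT k1 by exact: measurable_maxr.
have mk2 : measurable_fun setT k2.
  by apply: measurable_maxr => //; exact: measurableT_comp.
have k1_ge0 s : (0 <= k1 s)%R by rewrite le_max lexx orbT.
have k2_ge0 s : (0 <= k2 s)%R by rewrite le_max lexx orbT.
have i1 : (P z).-integrable setT (EFin \o (fun x => k1 (t x) * Phi x)%R).
  apply: le_norm_integrable ik.
    by apply: measurable_funM; [exact: measurableT_comp|exact: mPhi].
  by move=> x; rewrite !normrM ler_wpM2r// max0_le_norm.
have i2 : (P z).-integrable setT (EFin \o (fun x => k2 (t x) * Phi x)%R).
  apply: le_norm_integrable ik.
    by apply: measurable_funM; [exact: measurableT_comp|exact: mPhi].
  by move=> x; rewrite !normrM ler_wpM2r// (le_trans (max0_le_norm _))// normrN.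
transitivity (\int[P z]_x ((k1 (t x) * Phi x)%:E - (k2 (t x) * Phi x)%:E)).
  by apply: eq_integral => x _; rewrite -EFinB -mulrBl subr_max0.
rewrite (integralB_EFin measurableT i1 i2).
by rewrite !ge0_complete_orthogonal// sube0.
Qed.

End complete_orthogonal.

(** * Derivatives of logarithms in the parameter *)

(** Near [a], [g] is the exponential of its logarithm, so the chain rule turns derivability of the
    log density into that of the density. *)
Lemma is_derive_of_ln (R : realType) (g : R -> R) (a : R) :
  (\forall u \near a, 0 < g u) -> derivable (fun u => ln (g u)) a 1 ->
  is_derive a 1 g (g a * derive1 (fun u => ln (g u)) a).
Proof.
move=> g0 dg.
have dlg : is_derive a 1 (fun u => ln (g u)) (derive1 (fun u => ln (g u)) a).
  by rewrite derive1E; exact: derivableP.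
have ga : expR (ln (g a)) = g a.
  by rewrite lnK// posrE; exact: nbhs_singleton g0.
apply: (@near_eq_is_derive _ _ _ (expR \o (fun u => ln (g u)))).
  by near=> u; rewrite /= lnK// posrE; near: u.
rewrite -ga.
exact: is_derive1_comp (is_derive_expR _) dlg.
Unshelve. all: by end_near. Qed.

(** Puts the integrand of [rqi_interchange] in the form of a function times the density, so that its
    integral becomes an expectation. *)
Lemma derive1M_ln (R : realType) (phi g : R -> R) (a : R) :
  (\forall u \near a, 0 < g u) -> derivable (fun u => ln (g u)) a 1 ->
  derivable phi a 1 ->
  derive1 (fun u => phi u * g u) a =
  (derive1 phi a + phi a * derive1 (fun u => ln (g u)) a) * g a.
Proof.
move=> g0 dg dphi; have dg' := is_derive_of_ln g0 dg.
have [dg1 dgE] := dg'.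
rewrite derive1E deriveM//.
rewrite dgE !derive1E /GRing.scale /= mulrDl addrC.
by rewrite (mulrC (g a)) mulrAC -mulrA.
Qed.

(** Near [a], the logarithm of [h] is a difference of two derivable logarithms; smoothness of the
    factor [h] is thus obtained rather than assumed. *)
Lemma derive1_ln_mul (R : realType) (f g h : R -> R) (a : R) :
  (\forall u \near a, [/\ 0 < g u, 0 < h u & f u = g u * h u]) ->
  derivable (fun u => ln (f u)) a 1 -> derivable (fun u => ln (g u)) a 1 ->
  derivable (fun u => ln (h u)) a 1 /\
  derive1 (fun u => ln (f u)) a =
    derive1 (fun u => ln (g u)) a + derive1 (fun u => ln (h u)) a.
Proof.
move=> fgh df dg.
have lnE : \forall u \near a,
    ((fun u => ln (f u)) \- (fun u => ln (g u))) u = ln (h u).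
  near=> u.
  have [g0 h0 fE] : [/\ 0 < g u, 0 < h u & f u = g u * h u] by near: u.
  by rewrite /= fE lnM ?posrE// addrC addKr.
split; first by apply: near_eq_derivable lnE _; exact: derivableB.
by rewrite !derive1E -(near_eq_derive _ lnE) deriveB// addrCA subrr addr0.
Unshelve. all: by end_near. Qed.

(* The derivative itself need not be measurable in [s], as nothing is known at
   the points where it does not exist; an upper limit of difference quotients
   is a measurable version of it. *)
Lemma measurable_derive1 d (S : measurableType d) (R : realType)
    (F : S -> R -> R) (A : set R) (a : R) : open A -> A a ->
  (forall u, A u -> measurable_fun setT (F^~ u)) ->
  exists2 k : S -> R, measurable_fun setT k &
    forall s, derivable (F s) a 1 -> k s = derive1 (F s) a.
Proof.
move=> oA Aa mF.
have /nbhs_ballP[e /= e0 eA] : nbhs a A by exact: open_nbhs_nbhs.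
(* These positive increments tend to zero and stay below [e], so every difference quotient evaluates
   [F] inside [A], where it is measurable in [s]. *)
pose u n : R := e / 2 * harmonic n.
have u_gt0 n : 0 < u n by rewrite mulr_gt0 ?divr_gt0// harmonic_gt0.
have Au n : A (u n + a).
  apply: eA; rewrite /ball /= opprD addrCA subrr addr0 normrN gtr0_norm//.
  rewrite /u -mulrA gtr_pMr// (@le_lt_trans _ _ 2^-1)//.
    by rewrite ler_piMr// invf_le1// ler1n.
  by rewrite invf_lt1// ltr1n.
have u0 : u n @[n --> \oo] --> 0.
  rewrite -[X in _ --> X](mulr0 (e / 2)).
  by apply: cvgM; [exact: cvg_cst|exact: cvg_harmonic].
pose k_ n s := ((u n)^-1 * (F s (u n + a) - F s a))%:E.
exists (fun s => fine (limn_esup (k_^~ s))).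
  apply: measurableT_comp => //; apply: measurable_fun_limn_esup => n.
  apply/measurable_EFinP; apply: measurable_funM => //.
  by apply: measurable_funB; exact: mF.
move=> s dF.
(* Where the derivative exists, it is the limit from the right, hence along [u], and the upper limit
   equals it. *)
have h : (x^-1 * (F s (x + a) - F s a)) @[x --> 0^'+] --> derive1 (F s) a.
  apply: cvg_dnbhs_at_right; rewrite -/(derive1 (F s) a) /derive1.
  have : cvg ((fun h => h^-1 *: (F s (h + a) - F s a)) @ 0^').
    by move: dF; rewrite /derivable /=; under eq_fun do rewrite [_%:A]mulr1.
  by [].
have /cvg_at_rightP/(_ u)/(_ (conj u_gt0 u0)) uF := h.
have kF : k_^~ s n @[n --> \oo] --> (derive1 (F s) a)%:E.
  by apply: cvg_EFin => //; exact: nearW.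
by rewrite (cvg_limn_einf_sup kF).2.
Qed.

(** * The Cauchy-Schwarz inequality and its equality case *)

Section projection.
Context d (T : measurableType d) (R : realType) (P : probability T R).
Variables phi psi : T -> R.
Hypotheses (phi2 : phi \in Lfun P 2%:E) (psi2 : psi \in Lfun P 2%:E).

Let a := \int[P]_x (phi x ^+ 2).
Let b := \int[P]_x (phi x * psi x).
Let c := \int[P]_x (psi x ^+ 2).
Hypothesis c_gt0 : 0 < c.

Let iphi : P.-integrable setT (EFin \o (fun x => phi x ^+ 2)).
Proof. exact: Lfun2_integrable_sqr. Qed.

Let ipsi : P.-integrable setT (EFin \o (fun x => psi x ^+ 2)).
Proof. exact: Lfun2_integrable_sqr. Qed.

Let iphipsi : P.-integrable setT (EFin \o (fun x => phi x * psi x)).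
Proof. exact/Lfun1_integrable/Lfun2_mul_Lfun1. Qed.

(** The component of [phi] orthogonal to [psi] in L2(P), with [b / c] the projection coefficient;
    its squared norm is the gap in the Cauchy-Schwarz inequality. *)
Let residual x := phi x - b / c * psi x.

Let residualE x : residual x ^+ 2 =
  phi x ^+ 2 + (- (b / c *+ 2) * (phi x * psi x) + (b / c) ^+ 2 * psi x ^+ 2).
Proof. by rewrite /residual; ring. Qed.

Let icross : P.-integrable setT
  (EFin \o (fun x => - (b / c *+ 2) * (phi x * psi x))).
Proof. exact: (integrableZl measurableT (- (b / c *+ 2)) iphipsi). Qed.

Let isquare : P.-integrable setT
  (EFin \o (fun x => (b / c) ^+ 2 * psi x ^+ 2)).
Proof. exact: (integrableZl measurableT ((b / c) ^+ 2) ipsi). Qed.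

Let iresidual : P.-integrable setT (EFin \o (fun x => residual x ^+ 2)).
Proof.
have i := integrableD measurableT iphi (integrableD measurableT icross isquare).
apply: eq_integrable i => //.
by move=> x _; rewrite /= residualE !EFinD.
Qed.

Let residual_int : \int[P]_x (residual x ^+ 2) = a - b ^+ 2 / c.
Proof.
under eq_Rintegral do rewrite residualE.
rewrite RintegralD//; last exact: (integrableD measurableT icross isquare).
rewrite RintegralD// !RintegralZl// -/a -/b -/c.
by field; rewrite gt_eqF.
Qed.

Lemma Rintegral_cauchy_schwarz : b ^+ 2 / c <= a.
Proof.
rewrite -subr_ge0 -residual_int; apply: Rintegral_ge0 => x _.
exact: sqr_ge0.
Qed.

(** Equality means that the residual has norm zero, so it vanishes almost everywhere. *)
Lemma Rintegral_cauchy_schwarz_eq : b ^+ 2 / c = a ->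
  {ae P, forall x, phi x = b / c * psi x}.
Proof.
move=> bca.
have r0 : (\int[P]_x (residual x ^+ 2)%:E = 0)%E.
  rewrite -[LHS]fineK; last exact: integrable_fin_num iresidual.
  congr EFin; rewrite -[LHS]/(\int[P]_x (residual x ^+ 2)).
  by rewrite residual_int bca subrr.
have /ae_eq_integral_abs : (\int[P]_x `|(residual x ^+ 2)%:E| = 0)%E.
  rewrite -[RHS]r0; apply: eq_integral => x _.
  by rewrite gee0_abs// lee_fin sqr_ge0.
move=> /(_ measurableT (measurable_int _ iresidual)).
apply: filterS => x /(_ I) [] /eqP; rewrite sqrf_eq0 subr_eq0.
by move=> /eqP.
Qed.

End projection.

(** * The expected derivative of an inference function *)

Section expectation_dpar.
Context d (X : measurableType d) (R : realType).
Variables (lambda : {sigma_finite_measure set X -> \bar R}).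
Variables (Theta : set R) (Z : Type).
Variables (P : R -> Z -> probability X R) (p : X -> R -> Z -> R).
Hypothesis Theta_open : open Theta.
Hypothesis p_density : forall theta z, Theta theta ->
  is_density lambda (P theta z) (fun x => p x theta z).
Hypothesis p_gt0 : forall x theta z, Theta theta -> 0 < p x theta z.
Hypothesis score_ae : forall theta z, Theta theta ->
  {ae lambda, forall x, derivable (fun u => ln (p x u z)) theta 1}.
Hypothesis score_L2 : forall theta z, Theta theta ->
  (fun x => score p x theta z) \in Lfun (P theta z) 2%:E.

Lemma expectation_dpar (Phi : X -> R -> R) theta z :
  regular_inference lambda Theta P p Phi -> Theta theta ->
  fine 'E_(P theta z)[fun x => derive1 (Phi x) theta] =
  - \int[P theta z]_x (Phi x theta * score p x theta z).
Proof.
move=> [L20P dP iP intP _ _] Ttheta.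
have Tnear : \forall u \near theta, Theta u by exact: open_nbhs_nbhs.
have [mp pE] := p_density z Ttheta.
have p0 x : 0 <= p x theta z by rewrite ltW// p_gt0.
(* The interchange condition integrates against [lambda], whereas [g] below, a measurable version of
   the derivative of [Phi], is determined only up to [P theta z]-null sets. *)
have ae_lambda Q : {ae P theta z, forall x, Q x} -> {ae lambda, forall x, Q x}.
  by move=> /(negligible_density mp p0 pE _ (fun x => p_gt0 x z Ttheta)).
have [g ig gE] := intP theta z Ttheta.
have mg : measurable_fun setT g.
  by apply/measurable_EFinP; exact: measurable_int ig.
have Phi2 : (fun x => Phi x theta) \in Lfun (P theta z) 2%:E.
  by case: (L20P theta z Ttheta).
have il : (P theta z).-integrable setT
    (EFin \o (fun x => Phi x theta * score p x theta z)).
  exact/Lfun1_integrable/(Lfun2_mul_Lfun1 Phi2)/score_L2.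
have ml : measurable_fun setT (fun x => Phi x theta * score p x theta z).
  by apply/measurable_EFinP; exact: measurable_int il.
(* As [Theta] is open, [Phi] has mean zero at all parameters near [theta], so the differentiated
   function is locally the zero constant. *)
have mean0 : derive1 (fun u => \int[lambda]_x (Phi x u * p x u z)) theta = 0.
  rewrite derive1E (@near_eq_derive _ _ _ _ (cst 0)) ?derive_cst//.
  near=> u; have Tu : Theta u by near: u.
  have [/[!inE]/andP[/[!inE]/= mPhi _] Phi0] := L20P u z Tu.
  have [mpu pEu] := p_density z Tu.
  rewrite /Rintegral -(integral_density mpu _ pEu)//; last first.
    by move=> x; rewrite ltW// p_gt0.
  by move: Phi0; rewrite unlock => ->.
have := iP theta z Ttheta; rewrite mean0.
rewrite (@ae_eq_integralT _ _ _ lambda _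
  (fun x => ((g x + Phi x theta * score p x theta z) * p x theta z)%:E));
  last first.
  apply: filterS3 (dP theta z Ttheta) (score_ae z Ttheta) (ae_lambda _ gE).
  move=> x dPhi dp <-.
  congr EFin; apply: derive1M_ln => //.
  by near=> u; apply: p_gt0; near: u.
rewrite -(integral_density mp p0 pE); last exact: measurable_funD.
under eq_integral do rewrite EFinD.
rewrite (integralD_EFin measurableT ig il).
have EgE : {ae P theta z, forall x, (derive1 (Phi x) theta)%:E = (g x)%:E}.
  by apply: filterS gE => x /= <-.
rewrite -(ae_eq_integralT EgE).
have Efin : ('E_(P theta z)[fun x => derive1 (Phi x) theta] \is a fin_num)%E.
  by rewrite unlock (ae_eq_integralT EgE); exact: integrable_fin_num ig.
have ilfin := integrable_fin_num measurableT il.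
(* The two expectations sum to zero; both being finite, the equation can be solved in the reals. *)
rewrite /Rintegral => /esym /eqP.
move: Efin; rewrite unlock => Efin.
rewrite -(fineK Efin) -(fineK ilfin) -EFinD => /eqP[] /eqP.
by rewrite addr_eq0 => /eqP ->.
Unshelve. all: by end_near. Qed.

End expectation_dpar.

(** * Optimality, and uniqueness up to equivalence *)

Theorem theorem6 (R : realType)
    (d d' : measure_display) (X : measurableType d) (S : measurableType d')
    (lambda : {sigma_finite_measure set X -> \bar R})
    (Theta : set R) (Z : Type)
    (P : R -> Z -> probability X R) (p : X -> R -> Z -> R)
    (t : {mfun X >-> S}) (f : S -> X -> R -> R) (h : S -> R -> Z -> R)
    (Theta_open : open Theta)
    (p_density : forall theta z, Theta theta ->
       is_density lambda (P theta z) (fun x => p x theta z))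
    (p_inj : forall theta1 theta2 z1 z2, Theta theta1 -> Theta theta2 ->
       (forall x, p x theta1 z1 = p x theta2 z2) ->
       theta1 = theta2 /\ z1 = z2)
    (p_gt0 : forall x theta z, Theta theta -> 0 < p x theta z)
    (score_ae : forall theta z, Theta theta ->
       {ae lambda, forall x, derivable (fun u => ln (p x u z)) theta 1})
    (score_regular : regular_quasi_inference lambda Theta P p (score p))
    (f_gt0 : forall x theta, Theta theta -> 0 < f (t x) x theta)
    (h_meas : forall theta z, Theta theta ->
       measurable_fun setT (fun s => h s theta z))
    (factorization : forall x theta z, Theta theta ->
       p x theta z = f (t x) x theta * h (t x) theta z)
    (t_complete : forall theta, Theta theta ->
       complete_class
         [set (distribution (P theta z) t : probability S R) | z in [set: Z]])
    (f_ae : forall theta, Theta theta ->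
       {ae lambda, forall x, derivable (fun u => ln (f (t x) x u)) theta 1}) :
  let Psi := fun (x : X) (theta : R) =>
    derive1 (fun u => ln (f (t x) x u)) theta in
  regular_inference lambda Theta P p Psi ->
  optimal lambda Theta P p Psi /\
  (forall Phi : X -> R -> R, optimal lambda Theta P p Phi ->
     equivalent Theta P Phi Psi).
Proof.
move=> Psi regPsi.
have score_L2 theta z : Theta theta ->
    (fun x => score p x theta z) \in Lfun (P theta z) 2%:E.
  by move=> Tt; case: (rqi_L20 score_regular z Tt).
have reg_L2 Phi theta z :
    regular_inference lambda Theta P p Phi -> Theta theta ->
    (fun x => Phi x theta) \in Lfun (P theta z) 2%:E.
  by move=> regPhi Tt; case: (rqi_L20 regPhi z Tt).
have h_gt0 x theta z : Theta theta -> 0 < h (t x) theta z.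
  move=> Tt; move: (p_gt0 x theta z Tt).
  by rewrite factorization// pmulr_rgt0// f_gt0.
(* [k] is a measurable version, on all of [S], of the derivative of the logarithm of [h] in the
   parameter. *)
have score_dec theta z : Theta theta ->
    exists2 k : S -> R, measurable_fun setT k &
    {ae P theta z, forall x, score p x theta z - Psi x theta = k (t x)}.
  move=> Tt.
  have mlnh u Tu := measurableT_comp (@measurable_ln R) (h_meas u z Tu).
  have [k mk kE] := measurable_derive1 (F := fun s u => ln (h s u z))
    Theta_open Tt mlnh.
  exists k => //; have [mp pE] := p_density theta z Tt.
  have p0 x : 0 <= p x theta z by rewrite ltW// p_gt0.
  apply/(negligible_density mp p0 pE _ (fun x => p_gt0 x theta z Tt)).
  apply: filterS2 (score_ae theta z Tt) (f_ae theta Tt) => x dp df.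
  have [|dh] := derive1_ln_mul _ dp df (h := fun u => h (t x) u z).
    have Tnear : \forall u \near theta, Theta u by exact: open_nbhs_nbhs.
    near=> u; have Tu : Theta u by near: u.
    by split; [exact: f_gt0|exact: h_gt0|exact: factorization].
  by rewrite (kE _ dh) /score /dpar => ->; rewrite addrC addKr.
have score_orth Phi theta z :
    regular_inference lambda Theta P p Phi -> Theta theta ->
    \int[P theta z]_x (Phi x theta * score p x theta z) =
    \int[P theta z]_x (Phi x theta * Psi x theta).
  move=> regPhi Tt.
  have [k mk kE] := score_dec theta z Tt.
  (* The completeness argument needs [Phi] integrable under every [z'], not only under the given
     [z]. *)
  have Phi1 z' : (P theta z').-integrable setT (EFin \o (fun x => Phi x theta)).
    have := Lfun_subset12 (fin_num_measure (P theta z') _ measurableT).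
    by move=> /(_ _ (reg_L2 Phi theta z' regPhi Tt)) /Lfun1_integrable.
  have mPhi : measurable_fun setT (fun x => Phi x theta).
    by apply/measurable_EFinP; exact: measurable_int (Phi1 z).
  have il := (Lfun1_integrable _ _).1
    (Lfun2_mul_Lfun1 (reg_L2 Phi theta z regPhi Tt) (score_L2 theta z Tt)).
  have iPsi := (Lfun1_integrable _ _).1
    (Lfun2_mul_Lfun1 (reg_L2 Phi theta z regPhi Tt)
       (reg_L2 Psi theta z regPsi Tt)).
  have idiff := integrableB measurableT il iPsi.
  have kPhi : {ae P theta z, forall x, k (t x) * Phi x theta =
      Phi x theta * score p x theta z - Phi x theta * Psi x theta}.
    by apply: filterS kE => x <-; rewrite mulrC mulrBr.
  (* [k] is not known to be square integrable by itself; integrability of the product comes from its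
     being almost everywhere a difference of two products of square integrable functions. *)
  have ik : (P theta z).-integrable setT
      (EFin \o (fun x => k (t x) * Phi x theta)).
    move/integrableP : idiff => [_ idiff]; apply/integrableP; split.
      apply/measurable_EFinP; apply: measurable_funM => //.
      exact: measurableT_comp.
    apply: le_lt_trans idiff; rewrite le_eqVlt; apply/orP; left; apply/eqP.
    by apply: ae_eq_integralT; apply: filterS kPhi => x /= ->.
  have : (\int[P theta z]_x (k (t x) * Phi x theta)%:E = 0)%E.
    apply: (complete_orthogonal (lambda := lambda) (P := P theta)
      (p := fun x z => p x theta z) (q := fun x => f (t x) x theta)
      (h := fun s z => h s theta z)) => //.
    - by move=> z'; exact: p_density.
    - by move=> x z'; exact: p_gt0.
    - by move=> x; exact: f_gt0.
    - by move=> z'; exact: h_meas.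
    - by move=> x z'; exact: factorization.
    - exact: t_complete.
    - by move=> z'; have [_] := rqi_L20 regPhi z' Tt; rewrite unlock.
  move=> k0; apply/eqP; rewrite -subr_eq0 -RintegralB//; apply/eqP.
  rewrite /Rintegral -[RHS]/(fine 0%E) -k0; congr fine.
  by apply: ae_eq_integralT; apply: filterS kPhi => x ->.
have sqr_gt0 Phi theta z :
    regular_inference lambda Theta P p Phi -> Theta theta ->
    0 < \int[P theta z]_x (Phi x theta ^+ 2).
  move=> regPhi Tt.
  have i2 := Lfun2_integrable_sqr (reg_L2 Phi theta z regPhi Tt).
  have := rqi_sqr_gt0 regPhi z Tt; rewrite unlock.
  by rewrite -(fineK (integrable_fin_num measurableT i2)) lte_fin.
have godambeE Phi theta z :
    regular_inference lambda Theta P p Phi -> Theta theta ->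
    godambe P Phi theta z =
    (\int[P theta z]_x (Phi x theta * Psi x theta)) ^+ 2 /
    \int[P theta z]_x (Phi x theta ^+ 2).
  move=> regPhi Tt; rewrite /godambe.
  rewrite (expectation_dpar Theta_open p_density p_gt0 score_ae score_L2 z)//.
  by rewrite sqrrN score_orth// unlock.
have godambe_Psi theta z : Theta theta ->
    godambe P Psi theta z = \int[P theta z]_x (Psi x theta ^+ 2).
  move=> Tt; rewrite godambeE//.
  under eq_Rintegral do rewrite -expr2.
  by rewrite expr2 mulfK// gt_eqF// sqr_gt0.
split.
  split=> // Phi regPhi theta z Tt.
  rewrite godambe_Psi// godambeE//.
  (* The two positive second moments trade places, which gives the inequality the form in which
     [Phi] is projected on [Psi]. *)
  rewrite ler_pdivrMr ?sqr_gt0// mulrC -ler_pdivrMr ?sqr_gt0//.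
  apply: Rintegral_cauchy_schwarz; [exact: reg_L2|exact: reg_L2|].
  exact: sqr_gt0.
move=> Phi [regPhi optPhi] theta z Tt.
have := optPhi Psi regPsi theta z Tt.
set b := \int[P theta z]_x (Phi x theta * Psi x theta).
set a := \int[P theta z]_x (Phi x theta ^+ 2).
set c := \int[P theta z]_x (Psi x theta ^+ 2).
have a0 : 0 < a by exact: sqr_gt0.
have c0 : 0 < c by exact: sqr_gt0.
rewrite godambe_Psi// godambeE// -/a -/b -/c => cb.
(* Optimality of [Phi] tested against [Psi] reverses the Cauchy-Schwarz inequality, which forces
   equality. *)
have ba : b ^+ 2 / c = a.
  apply/eqP; rewrite eq_le; apply/andP; split.
    by apply: Rintegral_cauchy_schwarz c0; exact: reg_L2.
  by rewrite ler_pdivlMr// mulrC -ler_pdivlMr.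
(* The constant is the projection coefficient; [b] cannot vanish, since otherwise [a] would be
   zero. *)
exists (b / c).
  rewrite mulf_neq0 ?invr_neq0 ?(gt_eqF c0)//; apply/eqP => b0.
  by move: a0; rewrite -ba b0 expr0n mul0r ltxx.
by apply: Rintegral_cauchy_schwarz_eq c0 ba; exact: reg_L2.
Unshelve. all: by end_near. Qed.
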